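(* The non-preemptive schedulability problem can be encoded into CNF using $O(NMT + MT^2\log T)$ clauses: for every instance with $N$ tasks, $M$ machines and time horizon $T$, there is a CNF formula with $O(NMT + MT^2\log T)$ clauses that is satisfiable if and only if the instance is schedulable.
   Context: Non-preemptive schedulability problem: there are $N$ tasks and $M$ machines, with a total timespan $T$ (times are integers in $[1,T]$). Task $i$ has a positive integer duration $d_i$ and a window $[r_i,e_i]$ with $1\le r_i\le e_i\le T$, and must be both started and finished within $[r_i,e_i]$, i.e., it is processed without interruption on a single machine during a time interval $[s_i, s_i+d_i]$ with $r_i\le s_i$ and $s_i+d_i\le e_i$. Machines work in parallel, but each machine processes at most one task at a time (the processing intervals of tasks assigned to the same machine must be disjoint). The instance is schedulable if such an assignment of machines and start times exists for all tasks. *)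

(* Defs.v *)
From mathcomp Require Import all_boot.

Set Implicit Arguments.
Unset Strict Implicit.
Unset Printing Implicit Defensive.

Record instance (N T : nat) := Instance {
  duration : 'I_N -> nat;
  release : 'I_N -> nat;
  deadline : 'I_N -> nat;
  duration_gt0 : forall i, 0 < duration i;
  release_ge1 : forall i, 1 <= release i;
  release_le_deadline : forall i, release i <= deadline i;
  deadline_le_horizon : forall i, deadline i <= T
}.

Record schedule (N M : nat) := Schedule {
  machine : 'I_N -> 'I_M;
  start : 'I_N -> nat
}.

Section Schedules.

Variables (N M T : nat) (touch : bool) (I : instance N T).

(* The processing interval of task i is [s_i, s_i + d_i], and integer times
   suffice to test disjointness since its endpoints are integers.  If [touch]
   is false the interval is closed, so two tasks sharing an endpoint conflict;
   if [touch] is true it is [s_i, s_i + d_i), so that a task may start on a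
   machine exactly when the previous one finishes. *)
Definition processed_at (S : schedule N M) (i : 'I_N) (t : nat) : bool :=
  (start S i <= t) &&
  (if touch then t < start S i + duration I i
   else t <= start S i + duration I i).

Definition valid_schedule (S : schedule N M) : Prop :=
  (forall i, release I i <= start S i /\
             start S i + duration I i <= deadline I i) /\
  (forall i j t, machine S i = machine S j ->
     processed_at S i t -> processed_at S j t -> i = j).

End Schedules.

Definition schedulable (N M T : nat) (touch : bool) (I : instance N T) : Prop :=
  exists S : schedule N M, valid_schedule touch I S.

(* The literal (x, true) is x and (x, false) is its negation. *)
Definition literal (V : Type) : Type := (V * bool)%type.
Definition clause (V : Type) : Type := seq (literal V).
Definition cnf (V : Type) : Type := seq (clause V).

Definition satisfies (V : Type) (v : V -> bool) (phi : cnf V) : bool :=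
  all (fun c : clause V => has (fun l : literal V => v l.1 == l.2) c) phi.

Definition satisfiable (V : Type) (phi : cnf V) : Prop :=
  exists v : V -> bool, satisfies v phi.

(* [inl (i, m, t)] says that task i starts at time t on machine m; the
   variables [inr k] are auxiliary. *)
Definition sched_var (N M T : nat) : Type :=
  ('I_N * 'I_M * 'I_T.+1 + nat)%type.

Definition represents (N M T : nat)
    (v : sched_var N M T -> bool) (S : schedule N M) : Prop :=
  forall (i : 'I_N) (m : 'I_M) (t : 'I_T.+1),
    v (inl (i, m, t)) = (machine S i == m) && (start S i == t).

(* A bare equivalence between satisfiability and schedulability is met by a
   constant formula chosen after deciding the instance.  An encoding must
   describe the solutions: its models, projected to the non-auxiliary
   variables, are exactly the valid schedules. *)
Definition encodes (N M T : nat) (touch : bool) (I : instance N T)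
    (phi : cnf (sched_var N M T)) : Prop :=
  (forall v, satisfies v phi ->
     exists2 S : schedule N M, valid_schedule touch I S & represents v S) /\
  (forall S : schedule N M, valid_schedule touch I S ->
     exists2 v, satisfies v phi & represents v S).

(* Main.v *)
(** For a task [i], machine [m] and time [t] let [x i m t] say that [i] starts on
    [m] at [t].  A sequential counter forces each task to have a unique start,
    and another one each pair [(m, t)] to start at most one task; both cost
    O(NMT) clauses.  The last bit of the second counter says that some task
    starts on [m] at [t].  Overlaps are excluded by busy bits [z m s t]: "a task
    started on [m] at [s] still runs at [t]".  Starting [i] at [s] sets the busy
    bit of its last time unit, busy bits propagate backwards in [t], and
    [z m s t] with [s < t] forbids any start at [(m, t)].  This costs
    O(NMT + MT^2) clauses, within the required bound. *)
Require Import Defs.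
From mathcomp Require Import all_boot zify.

Set Implicit Arguments.
Unset Strict Implicit.
Unset Printing Implicit Defensive.

(** * CNF combinators and the sequential at-most-one counter *)

Section Cnf.

Variable V : Type.
Implicit Types (v : V -> bool) (phi : cnf V).

Lemma satisfies_cat v phi psi :
  satisfies v (phi ++ psi) = satisfies v phi && satisfies v psi.
Proof. exact: all_cat. Qed.

Definition big_and (A : finType) (F : A -> cnf V) : cnf V :=
  flatten [seq F a | a <- enum A].

Lemma satisfies_big_andP (A : finType) (F : A -> cnf V) v :
  reflect (forall a, satisfies v (F a)) (satisfies v (big_and F)).
Proof.
have -> : satisfies v (big_and F) = all (fun a => satisfies v (F a)) (enum A).
  by rewrite /big_and; elim: (enum A) => //= a s IHs; rewrite satisfies_cat IHs.
apply: (iffP allP) => [H a|H a _]; last exact: H.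
by apply: H; rewrite mem_enum.
Qed.

Lemma size_big_and (A : finType) (F : A -> cnf V) n :
  (forall a, size (F a) <= n) -> size (big_and F) <= #|A| * n.
Proof.
move=> leFn; rewrite /big_and cardE.
elim: (enum A) => //= a s IHs.
by rewrite size_cat mulSn leq_add.
Qed.

Definition imply (a b : V) : clause V := [:: (a, false); (b, true)].
Definition exclude (a b : V) : clause V := [:: (a, false); (b, false)].

Lemma satisfies_imply v a b phi :
  satisfies v (imply a b :: phi) = (v a ==> v b) && satisfies v phi.
Proof. by rewrite /satisfies /= !eqbF_neg eqb_id orbF implybE. Qed.

Lemma satisfies_exclude v a b phi :
  satisfies v (exclude a b :: phi) = (v a ==> ~~ v b) && satisfies v phi.
Proof. by rewrite /satisfies /= !eqbF_neg orbF implybE. Qed.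

Lemma satisfies_nil v : satisfies v [::].
Proof. by []. Qed.

Definition satisfies_simp :=
  (satisfies_cat, satisfies_imply, satisfies_exclude, satisfies_nil, andbT).

(* [p k] is meant as "some [x a] with [enum_rank a < k] holds". *)
Definition at_most_one (A : finType) (x : A -> V) (p : nat -> V) : cnf V :=
  big_and (fun a : A => [:: imply (x a) (p (enum_rank a).+1);
                            imply (p (enum_rank a)) (p (enum_rank a).+1);
                            exclude (p (enum_rank a)) (x a)]).

Section AtMostOne.

Variables (A : finType) (x : A -> V) (p : nat -> V) (v : V -> bool).

Lemma size_at_most_one : size (at_most_one x p) <= #|A| * 3.
Proof. exact: size_big_and. Qed.

(** The first clause of [a] sets the bit just after its rank, and the second clauses of the later
    ranks carry it upwards; these stop at rank [#|A| - 1], hence the bound on [k]. *)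
Lemma at_most_one_counter a k : satisfies v (at_most_one x p) ->
  v (x a) -> enum_rank a < k <= #|A| -> v (p k).
Proof.
move=> /satisfies_big_andP sat xa; elim: k => // k IHk /andP[].
rewrite ltnS leq_eqVlt => /orP[/eqP <- _|ltak ltkA].
  by have := sat a; rewrite !satisfies_simp xa => /and3P[].
have := sat (enum_val (Ordinal ltkA)); rewrite enum_valK !satisfies_simp /=.
by rewrite IHk ?ltak 1?ltnW // => /and3P[].
Qed.

(** If the ranks differ, the variable of smaller rank sets the counter bit at the larger rank, where
    the third clause forbids the other variable. *)
Lemma at_most_one_sound a b : satisfies v (at_most_one x p) ->
  v (x a) -> v (x b) -> a = b.
Proof.
move=> sat; wlog leab : a b / enum_rank a <= enum_rank b => [hw xa xb|xa xb].
  by case/orP: (leq_total (enum_rank a) (enum_rank b)) => /hw ->.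
move: leab; rewrite leq_eqVlt => /orP[/eqP/val_inj/enum_rank_inj //|ltab].
have pb : v (p (enum_rank b)).
  by apply: at_most_one_counter sat xa _; rewrite ltab ltnW.
move/satisfies_big_andP: sat => /(_ b).
by rewrite !satisfies_simp pb xb /= !andbF.
Qed.

Lemma at_most_one_complete :
  (forall a b, v (x a) -> v (x b) -> a = b) ->
  (forall k, v (p k) = [exists a, (enum_rank a < k) && v (x a)]) ->
  satisfies v (at_most_one x p).
Proof.
move=> uniq_x pE; apply/satisfies_big_andP => a; rewrite !satisfies_simp !pE.
apply/and3P; split; apply/implyP.
- by move=> xa; apply/existsP; exists a; rewrite ltnSn.
- case/existsP=> b /andP[ltba xb]; apply/existsP; exists b.
  by rewrite xb ltnS ltnW.
- case/existsP=> b /andP[ltba xb]; apply: contraL ltba => xa.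
  by rewrite (uniq_x _ _ xa xb) ltnn.
Qed.

End AtMostOne.

End Cnf.

Lemma encodes_equisatisfiable N M T touch (I : instance N T)
    (phi : cnf (sched_var N M T)) :
  encodes touch I phi -> satisfiable phi <-> schedulable M touch I.
Proof.
case=> sound complete; split=> [[v /sound[S]]|[S /complete[v]]].
  by exists S.
by exists v.
Qed.

(** Without tasks the generic encoding still has busy clauses, whereas the required bound is zero
    for [T <= 1]; the empty formula handles this case. *)
Lemma encodes_no_task M T touch (I : instance 0 T) :
  @encodes 0 M T touch I [::].
Proof.
split=> [v _|S _]; last by exists (fun=> false) => // -[].
by exists (Schedule (fun i : 'I_0 => match i with Ordinal _ lt0 =>
    False_rect _ (Bool.diff_false_true lt0) end) (fun=> 0)); [split=> -[] | case].
Qed.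

(** * The encoding and its number of clauses *)

Section Encoding.

Variables (N M T : nat) (touch : bool) (I : instance N T).

Local Notation var := (sched_var N M T).

(* The three summands index the counter of each task over the pairs
   (machine, time), the counter of each pair over the tasks, and the busy bits. *)
Definition aux : Type :=
  ('I_N * nat + 'I_M * 'I_T.+1 * nat + 'I_M * 'I_T.+1 * nat)%type.

(** Injectivity of [pickle] keeps the three families of auxiliary bits apart within the natural
    numbers. *)
Definition aux_var (a : aux) : var := inr (pickle a).
Definition start_var i (mt : 'I_M * 'I_T.+1) : var := inl (i, mt.1, mt.2).
Definition task_counter i k := aux_var (inl (inl (i, k))).
Definition slot_counter mt k := aux_var (inl (inr (mt, k))).
Definition busy m s t := aux_var (inr (m, s, t)).

Definition in_window i (t : nat) :=
  (release I i <= t) && (t + duration I i <= deadline I i).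

(* When touching is allowed, the finishing time is no longer occupied. *)
Definition last_busy i s := s + duration I i - touch.

(** Durations are positive, so the truncated subtraction of [touch] is exact; both conventions
    become closed integer intervals and are treated uniformly afterwards. *)
Lemma processed_atE (S : schedule N M) i t :
  processed_at touch I S i t = (start S i <= t <= last_busy i (start S i)).
Proof.
rewrite /processed_at /last_busy; congr andb.
have := duration_gt0 I i; case: touch => ?; last by rewrite subn0.
by lia.
Qed.

Definition start_clauses i : cnf var :=
  [seq (start_var i mt, true) | mt <- enum {: 'I_M * 'I_T.+1}]
  :: at_most_one (start_var i) (task_counter i).

Definition window_clauses i (mt : 'I_M * 'I_T.+1) : cnf var :=
  if in_window i mt.2 then [:: imply (start_var i mt) (busy mt.1 mt.2 (last_busy i mt.2))]
  else [:: [:: (start_var i mt, false)]].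

Definition slot_clauses mt : cnf var :=
  at_most_one (start_var^~ mt) (slot_counter mt).

Definition busy_clauses (mt : 'I_M * 'I_T.+1) (t : 'I_T.+1) : cnf var :=
  imply (busy mt.1 mt.2 t.+1) (busy mt.1 mt.2 t)
  :: if mt.2 < t then [:: exclude (busy mt.1 mt.2 t) (slot_counter (mt.1, t) N)]
     else [::].

Definition encoding : cnf var :=
  big_and start_clauses ++ big_and (fun i => big_and (window_clauses i))
  ++ big_and slot_clauses ++ big_and (fun mt => big_and (busy_clauses mt)).

Lemma size_encoding :
  size encoding <=
    N * (M * T.+1 * 3).+1 + N * (M * T.+1)
    + M * T.+1 * (N * 3) + M * T.+1 * (T.+1 * 2).
Proof.
have cardMT : #|{: 'I_M * 'I_T.+1}| = M * T.+1 by rewrite card_prod !card_ord.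
rewrite /encoding !size_cat !addnA !leq_add //.
- rewrite -[X in _ <= X * _]card_ord; apply: size_big_and => i /=.
  by rewrite ltnS -cardMT size_at_most_one.
- rewrite -[X in _ <= X * _]card_ord; apply: size_big_and => i.
  rewrite -cardMT -[X in _ <= X]muln1; apply: size_big_and => mt.
  by rewrite /window_clauses; case: ifP.
- rewrite -cardMT; apply: size_big_and => mt.
  by rewrite -[X in _ <= X * _]card_ord size_at_most_one.
- rewrite -cardMT; apply: size_big_and => mt.
  rewrite -[X in _ <= X * _]card_ord; apply: size_big_and => t.
  by rewrite /busy_clauses /=; case: ifP.
Qed.

(** * From models to schedules *)

Lemma encoding_sound v : satisfies v encoding ->
  exists2 S : schedule N M, valid_schedule touch I S & represents v S.
Proof.
rewrite !satisfies_cat => /and4P[/satisfies_big_andP sat_start].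
move=> /satisfies_big_andP sat_win /satisfies_big_andP sat_slot.
move=> /satisfies_big_andP sat_busy.
have ex_start i : exists mt, v (start_var i mt).
  have := sat_start i; rewrite /start_clauses /satisfies /= => /andP[].
  rewrite has_map => /hasP[mt _ /= /eqP vi] _.
  by exists mt.
pose st i : 'I_M * 'I_T.+1 := xchoose (ex_start i).
have v_st i : v (start_var i (st i)) := xchooseP (ex_start i).
have st_uniq i mt : v (start_var i mt) -> mt = st i.
  move=> vi; have := sat_start i; rewrite /start_clauses /satisfies /=.
  by case/andP=> _ sat_i; apply: at_most_one_sound sat_i vi (v_st i).
have win i : in_window i (st i).2 /\
    v (busy (st i).1 (st i).2 (last_busy i (st i).2)).
  have /satisfies_big_andP/(_ (st i)) := sat_win i; rewrite /window_clauses.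
  case: ifP => _; first by rewrite !satisfies_simp v_st.
  by rewrite /satisfies /= v_st.
exists (Schedule (fun i => (st i).1) (fun i => (st i).2)); last first.
  move=> i m t /=; apply/idP/andP => [vi|[/eqP eqm /eqP eqt]].
    by rewrite -(st_uniq i (m, t) vi) !eqxx.
  have -> : inl (i, m, t) = start_var i (st i); last exact: v_st.
  by rewrite /start_var eqm; congr (inl (_, _)); apply: val_inj.
split=> /= [i|i j t].
  by case: (win i) => /andP[].
rewrite !processed_atE /=.
wlog le_ij : i j / (st i).2 <= (st j).2 => [hw eqm pi pj|eqm].
  case/orP: (leq_total (st i).2 (st j).2) => [le_ij|le_ji]; first exact: hw.
  by apply/esym; apply: hw le_ji _ pj pi.
move=> /andP[_ le_ti] /andP[le_jt _].
have le_ji : (st j).2 <= last_busy i (st i).2 by apply: leq_trans le_ti.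
(* Equal start times put both tasks in one slot, whose counter identifies them. Otherwise [j] starts
   strictly later, and the busy bit of [i] at that time gives a contradiction. *)
move: le_ij; rewrite leq_eqVlt => /orP[/eqP/val_inj eqt|lt_ij].
  have eq_st : st i = st j by rewrite (surjective_pairing (st i)) eqm eqt -surjective_pairing.
  by apply: (at_most_one_sound (sat_slot (st i))); rewrite ?v_st // eq_st v_st.
(* Descending from [n.+1] to [n] uses the busy clause at time [n], an element of ['I_T.+1]; this is
   why [n] may reach [T.+1]. *)
have busy_le k n : v (busy (st i).1 (st i).2 n) -> n <= T.+1 -> k <= n ->
    v (busy (st i).1 (st i).2 k).
  elim: n => [|n IHn] vn lenT; first by rewrite leqn0 => /eqP ->.
  rewrite leq_eqVlt => /orP[/eqP -> //|]; rewrite ltnS; apply: IHn; last exact: ltnW.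
  have /satisfies_big_andP/(_ (Ordinal lenT)) := sat_busy (st i).
  by rewrite /busy_clauses satisfies_imply vn => /andP[].
have [/andP[_ le_dl] busy_i] := win i.
have le_T : last_busy i (st i).2 <= T.+1.
  rewrite /last_busy; have := deadline_le_horizon I i; lia.
have busy_j := busy_le _ _ busy_i le_T le_ji.
have started_j : v (slot_counter (st j) N).
  apply: (at_most_one_counter (sat_slot (st j)) (v_st j)).
  by have := ltn_ord (enum_rank j); rewrite {2 4}card_ord leqnn andbT.
have /satisfies_big_andP/(_ (st j).2) := sat_busy (st i).
rewrite /busy_clauses lt_ij !satisfies_simp busy_j eqm -surjective_pairing.
by rewrite started_j andbF.
Qed.

(** * From schedules to models *)

Section Assignment.

Variable S : schedule N M.

Definition starts i (mt : 'I_M * 'I_T.+1) :=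
  (machine S i == mt.1) && (start S i == mt.2).

(** Busy bits are also true at times before [s], so that backward propagation holds without a lower
    limit; the guard [mt.2 < t] of the exclusion clauses makes this harmless. *)
Definition aux_value (a : aux) : bool :=
  match a with
  | inl (inl (i, k)) => [exists mt, (enum_rank mt < k) && starts i mt]
  | inl (inr (mt, k)) => [exists i : 'I_N, (enum_rank i < k) && starts i mt]
  | inr (m, s, t) => [exists i, starts i (m, s) && (t <= last_busy i s)]
  end.

Definition assignment (x : var) : bool :=
  match x with
  | inl (i, m, t) => starts i (m, t)
  | inr k => if unpickle k is Some a then aux_value a else false
  end.

Lemma assignment_aux a : assignment (aux_var a) = aux_value a.
Proof. by rewrite /= pickleK. Qed.

Lemma assignment_start i mt : assignment (start_var i mt) = starts i mt.
Proof. by case: mt. Qed.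

Lemma starts_inj i mt mt' : starts i mt -> starts i mt' -> mt = mt'.
Proof.
case: mt mt' => [m t] [m' t'] /andP[/eqP /= <- /eqP eqt] /andP[/eqP /= <- /eqP].
by rewrite eqt => /val_inj ->.
Qed.

Lemma encoding_complete : valid_schedule touch I S -> satisfies assignment encoding.
Proof.
case=> win disj.
(* Both tasks are being processed at time [t], the start of [j]. *)
have disjoint_starts i j m (s t : 'I_T.+1) : starts i (m, s) -> starts j (m, t) ->
    s <= t <= last_busy i s -> i = j.
  move=> /andP[/eqP /= mi /eqP si] /andP[/eqP /= mj /eqP sj] /andP[le_st le_t].
  apply: (disj i j t); rewrite ?mi ?mj ?processed_atE ?si ?sj ?le_st ?leqnn //=.
  by rewrite /last_busy; have := duration_gt0 I j; case: touch; lia.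
have last_ge i s : s <= last_busy i s.
  by rewrite /last_busy; have := duration_gt0 I i; case: touch; lia.
have lt_start i : start S i < T.+1.
  by rewrite ltnS; have := deadline_le_horizon I i; have [_] := win i; lia.
rewrite !satisfies_cat; apply/and4P; split.
- apply/satisfies_big_andP => i; rewrite /start_clauses /satisfies /=.
  apply/andP; split.
    rewrite has_map; apply/hasP; exists (machine S i, Ordinal (lt_start i)).
      by rewrite mem_enum.
    by rewrite /= /starts !eqxx.
  apply: at_most_one_complete => [mt mt'|k].
    by rewrite !assignment_start; apply: starts_inj.
  by rewrite assignment_aux; apply: eq_existsb => mt; rewrite assignment_start.
- apply/satisfies_big_andP => i; apply/satisfies_big_andP => mt.
  rewrite /window_clauses; case: ifPn => out_win.
    rewrite !satisfies_simp assignment_start assignment_aux /=.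
    apply/implyP => si; apply/existsP; exists i.
    by rewrite leqnn andbT -surjective_pairing.
  rewrite /satisfies /= !orbF andbT eqbF_neg; apply: contra out_win.
  by case/andP=> _ /eqP <-; apply/andP; apply: win.
- apply/satisfies_big_andP => -[m t].
  apply: at_most_one_complete => [i j si sj|k]; last exact: assignment_aux.
  by apply: disjoint_starts si sj _; rewrite leqnn last_ge.
- apply/satisfies_big_andP => -[m s]; apply/satisfies_big_andP => t.
  rewrite /busy_clauses satisfies_imply !assignment_aux /=.
  apply/andP; split.
    apply/implyP => /existsP[i /andP[si lt_t]]; apply/existsP; exists i.
    by rewrite si ltnW.
  case: ifP => // lt_st; rewrite !satisfies_simp !assignment_aux /=.
  apply/implyP => /existsP[i /andP[si le_t]]; apply/negP => /existsP[j /andP[_ sj]].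
  have eq_ij : i = j by apply: disjoint_starts si sj _; rewrite le_t ltnW.
  (* A single task would start at both [s] and [t], although [s < t]. *)
  by move: sj; rewrite -eq_ij => /(starts_inj si) [eq_st]; rewrite eq_st ltnn in lt_st.
Qed.

End Assignment.

Lemma encoding_encodes : encodes touch I encoding.
Proof.
split=> [v|S valid_S]; first exact: encoding_sound.
exists (assignment S) => //; exact: encoding_complete.
Qed.

End Encoding.

(** * The size bound and the conclusion *)

(* At [T = 1] the logarithm vanishes, and the quadratic term is absorbed by
   [N * M * T] instead; this needs [0 < N]. *)
Lemma encoding_size_bound N M T : 0 < N -> 0 < M -> 0 < T ->
  N * (M * T.+1 * 3).+1 + N * (M * T.+1)
    + M * T.+1 * (N * 3) + M * T.+1 * (T.+1 * 2)
  <= 23 * (N * M * T + M * T ^ 2 * trunc_log 2 T).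
Proof.
move=> N0 M0 T0.
have le_NMT : N <= N * M * T by rewrite -mulnA leq_pmulr // muln_gt0 M0.
have le_S : M * T.+1 <= 2 * (M * T) by rewrite mulnCA leq_mul2l; lia.
have le_NS : N * (M * T.+1) <= 2 * (N * M * T).
  by have := leq_mul (leqnn N) le_S; lia.
have le_sq : M * T.+1 * T.+1 <= 4 * (N * M * T + M * T ^ 2 * trunc_log 2 T).
  have [T1|T_gt1] := leqP T 1.
    have -> : T = 1 by lia.
    by rewrite muln0 addn0; nia.
  have log_gt0 : 0 < trunc_log 2 T by rewrite trunc_log_gt0.
  have : M * T ^ 2 <= M * T ^ 2 * trunc_log 2 T by rewrite leq_pmulr.
  have : M * T.+1 * T.+1 <= 4 * (M * T ^ 2).
    have le_T2 : T.+1 * T.+1 <= 4 * T ^ 2 by nia.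
    by have := leq_mul (leqnn M) le_T2; lia.
  lia.
lia.
Qed.

Theorem theorem22 :
  exists C : nat,
  forall (N M T : nat) (touch : bool) (I : instance N T), 0 < M ->
  exists phi : cnf (sched_var N M T),
    [/\ size phi <= C * (N * M * T + M * T ^ 2 * trunc_log 2 T),
        satisfiable phi <-> schedulable M touch I
      & encodes touch I phi].
Proof.
(* The constant is 14 + 1 + 8: seven copies of [N * M * T.+1], each at most [2 * (N * M * T)]; one
   [N]; and twice [M * T.+1 * T.+1], each at most 4 times the target. *)
exists 23 => -[|N] M T touch I M0.
  exists [::]; have enc := encodes_no_task M touch I.
  by split=> //; apply: encodes_equisatisfiable.
have enc := encoding_encodes M touch I.
exists (encoding M touch I); split=> //; last exact: encodes_equisatisfiable.
apply: leq_trans (size_encoding M touch I) (encoding_size_bound _ _ _) => //.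
(* The window of the first task lies in [[1, T]], which forces [0 < T]. *)
apply: leq_trans (deadline_le_horizon I ord0).
exact: leq_trans (release_ge1 I ord0) (release_le_deadline I ord0).
Qed.
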